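(* Let $\oplus\subseteq[N]$ be a safe set and $\ominus\subseteq[N]$ a pruned set that are jointly compatible, let $\hat F^*_\tau\ge F^*_\tau$ (with $\hat F^*_\tau\in\mathbb{R}\cup\{+\infty\}$), and let $s\in[N]$. For any $S\subseteq\oplus$, if $$0\ <\ \min_{x\in\mathcal{X},\,F(x)\le\hat F^*_\tau} c(x,\xi^{(s)})\quad\text{s.t.}\quad c(x,\xi^{(\tilde s)})\le 0\ \ \forall\tilde s\in S,$$ then $s$ may be added to the pruned set, i.e. $\ominus\cup\{s\}$ is a pruned set.
   Context: Setting. $\xi$ is a random vector in $\mathbb{R}^p$ with finite support $\{\xi^{(1)},\dots,\xi^{(N)}\}$ of cardinality $N$ (so the scenarios $\xi^{(s)}$ are pairwise distinct), $[N]=\{1,\dots,N\}$, and $\pi^{(s)}=\mathbb{P}[\xi=\xi^{(s)}]$, with $\sum_{s}\pi^{(s)}=1$. Let $\mathcal{X}\subseteq\mathbb{R}^d$, $F:\mathbb{R}^d\to\mathbb{R}$, $c:\mathbb{R}^d\times\mathbb{R}^p\to\mathbb{R}$, $\tau\in(0,1)$, and let $M^{(s)}\in\mathbb{R}$ satisfy $M^{(s)}\ge\max_{x\in\mathcal{X}}c(x,\xi^{(s)})$ for each $s\in[N]$. For $S\subseteq[N]$ define $\nu(S)$ as the optimal value of $\min_{x\in\mathcal{X}}F(x)$ subject to $c(x,\xi^{(s)})\le 0$ for all $s\in S$. Infeasible minimization problems have value $+\infty$, unbounded ones $-\infty$. Standing assumptions. (A) For every $s\in[N]$, $\pi^{(s)}>0$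 and $\nu(\{s\})>-\infty$. (B) For every $x\in\mathcal{X}$, the function $c(x,\cdot)$ is quasi-convex on $\mathbb{R}^p$. Moreover, minima are attained: for every nonempty $S\subseteq[N]$ for which the problem defining $\nu(S)$ is feasible, that problem has a minimizer. Problem (MI-CCP), with optimal value $F^*_\tau$: minimize $F(x)$ over $x\in\mathcal{X}$, $z\in\{0,1\}^N$ subject to $\sum_{s=1}^N\pi^{(s)}z_s\ge 1-\tau$ and $c(x,\xi^{(s)})\le M^{(s)}(1-z_s)$ for all $s\in[N]$. Safe set: $\oplus\subseteq[N]$ is a safe set if including the equalities $z_s=1$ for every $s\in\oplus$ in (MI-CCP) does not increase its optimal value $F^*_\tau$. Pruned set: $\ominus\subseteq[N]$ is a pruned set if including the equalities $z_s=0$ for every $s\in\ominus$ in (MI-CCP) does not increase its optimal value $F^*_\tau$. Define $\mathbf{T}(\oplus,\ominus)=\{S\subseteq[N]\setminus\ominus : \oplus\subseteq S \text{ and } \sum_{s\in S}\pi^{(s)}\ge 1-\tau\}$. The pair $(\oplus,\ominus)$ is jointly compatible if $F^*_\tau=\min_{S\in\mathbf{T}(\oplus,\ominus)}\nu(S)$ (with value $+\infty$ for an empty minimum); equivalently, including both families of equalities in (MI-CCP) simultaneously does not increase its optimal value. *)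

(* Defs.v *)
From HB Require Import structures.
From mathcomp Require Export all_boot all_order all_algebra.
From mathcomp Require Export all_classical all_reals all_analysis.
Set Implicit Arguments.
Unset Strict Implicit.
Unset Printing Implicit Defensive.
Import Order.TTheory GRing.Theory Num.Theory.
Import numFieldNormedType.Exports.
Local Open Scope classical_set_scope.
Local Open Scope ring_scope.

(* Optimal value of "minimize f over A": +oo when A is empty, -oo when f is
   unbounded below on A; attainment is not built in. *)
Definition optval (R : realType) (T : Type) (A : set T) (f : T -> R) : \bar R :=
  ereal_inf [set (f x)%:E | x in A].

(* R^p is not given a sigma-algebra in the library; on R^p, Borel measurability
   is the same as measurability of every coordinate. *)
Definition random_vector (R : realType) (p : nat) (disp : measure_display)
    (Omega : measurableType disp) (Xi : Omega -> 'rV[R]_p) : Prop :=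
  forall j : 'I_p, measurable_fun [set: Omega] (fun w => Xi w ord0 j).

Definition quasi_convex (R : realType) (p : nat) (g : 'rV[R]_p -> R) : Prop :=
  forall (u v : 'rV[R]_p) (t : R), 0 <= t <= 1 ->
    g (t *: u + (1 - t) *: v) <= Num.max (g u) (g v).

Section ScenarioProblem.
Context (R : realType) (d p N : nat).
Context (X : set 'rV[R]_d) (F : 'rV[R]_d -> R) (c : 'rV[R]_d -> 'rV[R]_p -> R).
Context (xi : 'I_N -> 'rV[R]_p).

Definition scen_feasible (S : {set 'I_N}) : set 'rV[R]_d :=
  [set x | X x /\ forall s, s \in S -> c x (xi s) <= 0].

Definition nu (S : {set 'I_N}) : \bar R := optval (scen_feasible S) F.

Definition minima_attained : Prop :=
  forall S : {set 'I_N}, S != finset.set0 -> scen_feasible S !=set0 ->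
    exists2 x, scen_feasible S x & forall y, scen_feasible S y -> F x <= F y.

Context (prob : 'I_N -> R) (tau : R) (M : 'I_N -> R).

Definition mi_feasible : set ('rV[R]_d * {ffun 'I_N -> bool}) :=
  [set xz : 'rV[R]_d * {ffun 'I_N -> bool} | [/\ X xz.1,
    1 - tau <= \sum_(s < N) prob s * (xz.2 s)%:R &
    forall s, c xz.1 (xi s) <= M s * (1 - (xz.2 s)%:R)]].

Definition mi_value : \bar R := optval mi_feasible (fun xz => F xz.1).

(* Optimal value after adding the equalities z_s = b for all s in A. *)
Definition mi_value_fix (A : {set 'I_N}) (b : bool) : \bar R :=
  optval (mi_feasible `&`
          [set xz : 'rV[R]_d * {ffun 'I_N -> bool} | forall s, s \in A -> xz.2 s = b])
         (fun xz => F xz.1).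

Definition safe_set (A : {set 'I_N}) : Prop :=
  (mi_value_fix A true <= mi_value)%E.

Definition pruned_set (A : {set 'I_N}) : Prop :=
  (mi_value_fix A false <= mi_value)%E.

Definition Tsets (oplus ominus : {set 'I_N}) : {set {set 'I_N}} :=
  finset (fun S : {set 'I_N} =>
    [&& S \subset ~: ominus, oplus \subset S &
        1 - tau <= \sum_(s in S) prob s]).

Definition jointly_compatible (oplus ominus : {set 'I_N}) : Prop :=
  mi_value = \big[Order.min/+oo%E]_(S in Tsets oplus ominus) nu S.

Definition check_value (Fhat : \bar R) (S : {set 'I_N}) (s : 'I_N) : \bar R :=
  optval [set x | [/\ X x, ((F x)%:E <= Fhat)%E &
                      forall t, t \in S -> c x (xi t) <= 0]]
         (fun x => c x (xi s)).

End ScenarioProblem.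

(* Main.v *)
Require Import Defs.
From mathcomp Require Import all_boot all_order all_algebra.
From mathcomp Require Import all_classical all_reals all_analysis.
Set Implicit Arguments.
Unset Strict Implicit.
Unset Printing Implicit Defensive.
Import Order.TTheory GRing.Theory Num.Theory.
Import numFieldNormedType.Exports.
Local Open Scope classical_set_scope.
Local Open Scope ring_scope.

(** If the optimal value [F*] of the mixed-integer problem is [+oo], no equality
    can increase it.  Otherwise [F*] is, by joint compatibility, the value
    [nu S0] of one scenario selection [S0] that contains [oplus] and avoids
    [ominus], and it is attained at some [x] ([jointly_compatible_minimizer]).  Then
    [F x = F* <= Fhat] and [x] satisfies every constraint indexed by
    [S], a subset of [oplus] and hence of [S0], so [x] competes in the checking
    problem, whose positive optimal value forces [0 < c x (xi s)].  Therefore [s]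
    is not in [S0], and [x] together with the indicator of [S0] is a
    mixed-integer solution of value [F*] in which the variables of [ominus] and
    of [s] all vanish ([mi_value_fix_false_le]). *)

Section Optval.
Context (R : realType) (T : Type) (A : set T) (f : T -> R).

Lemma optval_le (x : T) : A x -> (optval A f <= (f x)%:E)%E.
Proof. by move=> Ax; apply: ereal_inf_lbound; exists x. Qed.

Lemma optval_minimizer (x : T) :
  A x -> (forall y, A y -> f x <= f y) -> optval A f = (f x)%:E.
Proof.
move=> Ax minx; apply/eqP; rewrite eq_le optval_le //=.
by apply: le_ereal_inf_tmp => _ [y Ay <-]; rewrite lee_fin minx.
Qed.

Lemma optval_lty_nonempty : (optval A f < +oo)%E -> A !=set0.
Proof.
move=> finA; apply/set0P/eqP => A0.
by move: finA; rewrite /optval A0 image_set0 ereal_inf0 ltxx.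
Qed.

End Optval.

Section ScenarioSelection.
Context (R : realType) (d p N : nat).
Context (X : set 'rV[R]_d) (F : 'rV[R]_d -> R) (c : 'rV[R]_d -> 'rV[R]_p -> R).
Context (xi : 'I_N -> 'rV[R]_p) (prob : 'I_N -> R) (tau : R) (M : 'I_N -> R).

(** The indicator of [S0] completes [x] to a mixed-integer solution: the
    constraints of [S0] hold by assumption, and [M t] is large enough to
    deactivate the others. *)
Lemma mi_value_fix_false_le (S0 A : {set 'I_N}) (x : 'rV[R]_d) :
    (forall t, (ereal_sup [set (c y (xi t))%:E | y in X] <= (M t)%:E)%E) ->
    scen_feasible X c xi S0 x -> 1 - tau <= \sum_(t in S0) prob t ->
    A \subset ~: S0 ->
  (mi_value_fix X F c xi prob tau M A false <= (F x)%:E)%E.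
Proof.
move=> bigM [Xx cx] S0prob sAS0.
pose z : {ffun 'I_N -> bool} := [ffun t => t \in S0].
apply: (@optval_le _ _ _ (fun xz => F xz.1) (x, z)); split; last first.
  by move=> t tA; rewrite ffunE; apply/negbTE; rewrite -finset.in_setC;
    apply: fintype.subsetP tA.
split=> //= [|t].
  rewrite (eq_bigr (fun t => if t \in S0 then prob t else 0)) -?big_mkcond //.
  by move=> t _; rewrite ffunE; case: ifP => _; rewrite ?mulr1 ?mulr0.
rewrite ffunE; have [tS0|_] := boolP (t \in S0).
  by rewrite subrr mulr0 cx.
rewrite subr0 mulr1 -lee_fin (le_trans _ (bigM t)) //.
by apply: ereal_sup_ubound; exists x.
Qed.

(** The strict inequality [tau < 1] makes the selection nonempty, as the
    attainment assumption requires. *)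
Lemma jointly_compatible_minimizer (oplus ominus : {set 'I_N}) :
    tau < 1 -> minima_attained X F c xi ->
    jointly_compatible X F c xi prob tau M oplus ominus ->
    (mi_value X F c xi prob tau M < +oo)%E ->
  exists S0 x, [/\ S0 \in Tsets prob tau oplus ominus,
    scen_feasible X c xi S0 x & mi_value X F c xi prob tau M = (F x)%:E].
Proof.
move=> tau1 att -> finT.
have [T0|[S1 S1T]] := set_0Vmem (Tsets prob tau oplus ominus).
  by move: finT; rewrite T0 big_set0 ltxx.
have [S0 S0T minE] := @eq_bigmin _ _ _ +oo%E S1 (mem (Tsets prob tau oplus ominus))
  (nu X F c xi) S1T (fun _ _ => leey _).
rewrite minE in finT *.
have S0neq0 : S0 != finset.set0.
  apply: contraTneq S0T => ->.
  by rewrite inE big_set0 subr_le0 leNgt tau1 !andbF.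
have [x S0x minx] := att S0 S0neq0 (optval_lty_nonempty finT).
by exists S0, x; split=> //; apply: optval_minimizer.
Qed.

End ScenarioSelection.

Theorem proposition3 (R : realType) (d p N : nat)
  (disp : measure_display) (Omega : measurableType disp)
  (P : probability Omega R) (Xi : Omega -> 'rV[R]_p) (xi : 'I_N -> 'rV[R]_p)
  (X : set 'rV[R]_d) (F : 'rV[R]_d -> R) (c : 'rV[R]_d -> 'rV[R]_p -> R)
  (prob : 'I_N -> R) (tau : R) (M : 'I_N -> R)
  (hXi : random_vector Xi)
  (hxi : injective xi)
  (hprob : forall s, P [set w | Xi w = xi s] = (prob s)%:E)
  (hprob1 : \sum_(s < N) prob s = 1)
  (htau : 0 < tau < 1)
  (hM : forall s, (ereal_sup [set (c x (xi s))%:E | x in X] <= (M s)%:E)%E)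
  (hA : forall s, 0 < prob s /\ (-oo < nu X F c xi [set s]%SET)%E)
  (hB : forall x, X x -> quasi_convex (c x))
  (hatt : minima_attained X F c xi)
  (oplus ominus : {set 'I_N})
  (hsafe : safe_set X F c xi prob tau M oplus)
  (hpruned : pruned_set X F c xi prob tau M ominus)
  (hcompat : jointly_compatible X F c xi prob tau M oplus ominus)
  (Fhat : \bar R)
  (hFhat_ninfty : Fhat != -oo%E)
  (hFhat : (mi_value X F c xi prob tau M <= Fhat)%E)
  (s : 'I_N) (S : {set 'I_N}) (hS : S \subset oplus)
  (hcheck : (0 < check_value X F c xi Fhat S s)%E) :
  pruned_set X F c xi prob tau M (ominus :|: [set s])%SET.
Proof.
have /andP[_ tau1] := htau.
rewrite /pruned_set.
have [->|mi_fin] := eqVneq (mi_value X F c xi prob tau M) +oo%E; first exact: leey.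
rewrite -ltey in mi_fin.
have [S0 [x [S0T [Xx cx] miE]]] :=
  jointly_compatible_minimizer tau1 hatt hcompat mi_fin.
move: S0T; rewrite inE => /and3P[S0ominus oplusS0 S0prob].
have cxs : 0 < c x (xi s).
  rewrite -lte_fin (lt_le_trans hcheck) //.
  apply: (@optval_le _ _ _ (fun y => c y (xi s))); split=> //.
    by rewrite -miE.
  by move=> t /(fintype.subsetP hS) /(fintype.subsetP oplusS0); apply: cx.
have sS0 : s \notin S0 by apply/negP => /cx; rewrite leNgt cxs.
rewrite miE; apply: mi_value_fix_false_le hM _ S0prob _ => //.
by rewrite finset.subUset finset.subsetC S0ominus finset.sub1set finset.in_setC.
Qed.
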